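(* The variety $\mathbf{BHp}_\vee$ of bounded $\vee$-hoops is coextensive as a category.
   Context: A hoop is an algebra $(H,\cdot,\to,1)$ such that $(H,\cdot,1)$ is a commutative monoid and, for all $x,y,z\in H$: $x\to x=1$; $x\to(y\to z)=(x\cdot y)\to z$; $(x\to y)\cdot x=(y\to x)\cdot y$. The natural order of a hoop is the partial order $x\leqslant y\iff x\to y=1$; every hoop has binary meets for it, given by $x\wedge y=(y\to x)\cdot y$. The pseudojoin is $x\sqcup y=((x\to y)\to y)\wedge((y\to x)\to x)$. A hoop is a $\vee$-hoop if $x\sqcup y$ is the join of $x$ and $y$ in the natural order for all $x,y$. A hoop is bounded if it has a bottom element $0$ for the natural order. $\mathbf{BHp}_\vee$ is the category of bounded $\vee$-hoops, with morphisms the maps preserving $\cdot,\to,1$ and $0$. A morphism $f\colon A\to X$ in a category with finite products is coextensive if: (1) $f$ admits pushouts along the two projections of every product diagram $A_1\leftarrow A\to A_2$, and the resulting pushouts $X_1\leftarrow X\to X_2$ form a product diagram; and (2) for every product diagram $A_1\leftarrow A\to A_2$, every product diagram $X_1\leftarrow X\to X_2$, and all morphisms $A_1\to X_1$, $A_2\to X_2$ which together with $f$ make the two evident squares commute, both squares are pushouts. A category is coextensive if it has finite products and every morphism in it is coextensive. *)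

(* Defs.v *)
From mathcomp Require Import all_boot.
From mathcomp Require Import boolp.

Set Implicit Arguments.
Unset Strict Implicit.
Unset Printing Implicit Defensive.

Record category : Type := Category {
  obj :> Type;
  hom : obj -> obj -> Type;
  idm : forall A : obj, hom A A;
  comp : forall A B C : obj, hom B C -> hom A B -> hom A C;
  comp_id_l : forall (A B : obj) (f : hom A B), comp (idm B) f = f;
  comp_id_r : forall (A B : obj) (f : hom A B), comp f (idm A) = f;
  compA : forall (A B C D : obj) (h : hom C D) (g : hom B C) (f : hom A B),
    comp h (comp g f) = comp (comp h g) f
}.

Declare Scope cat_scope.
Delimit Scope cat_scope with cat.
Notation "g ∘ f" := (comp g f) (at level 40, left associativity) : cat_scope.
Local Open Scope cat_scope.

Section CategoryNotions.
Variable C : category.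

(* The case n = 0 is the existence of a terminal object. *)
Definition has_finite_products : Prop :=
  forall (n : nat) (F : 'I_n -> C),
  exists (P : C) (p : forall i : 'I_n, hom P (F i)),
  forall (Y : C) (y : forall i : 'I_n, hom Y (F i)),
  exists! h : hom Y P, forall i : 'I_n, p i ∘ h = y i.

Definition is_product (A A1 A2 : C) (p1 : hom A A1) (p2 : hom A A2) : Prop :=
  forall (Y : C) (y1 : hom Y A1) (y2 : hom Y A2),
  exists! h : hom Y A, p1 ∘ h = y1 /\ p2 ∘ h = y2.

(*            f
        A --------> X
        |           |
      p |           | q
        v           v
        B --------> Y
              g               *)
Definition is_pushout (A X B Y : C) (f : hom A X) (p : hom A B)
    (q : hom X Y) (g : hom B Y) : Prop :=
  q ∘ f = g ∘ p /\
  forall (Z : C) (x : hom X Z) (b : hom B Z), x ∘ f = b ∘ p ->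
  exists! h : hom Y Z, h ∘ q = x /\ h ∘ g = b.

Definition admits_pushout (A X B : C) (f : hom A X) (p : hom A B) : Prop :=
  exists (Y : C) (q : hom X Y) (g : hom B Y), is_pushout f p q g.

Definition coextensive_morphism (A X : C) (f : hom A X) : Prop :=
  (forall (A1 A2 : C) (p1 : hom A A1) (p2 : hom A A2), is_product p1 p2 ->
     [/\ admits_pushout f p1, admits_pushout f p2
       & forall (X1 X2 : C) (q1 : hom X X1) (q2 : hom X X2)
                (g1 : hom A1 X1) (g2 : hom A2 X2),
           is_pushout f p1 q1 g1 -> is_pushout f p2 q2 g2 ->
           is_product q1 q2])
  /\
  (forall (A1 A2 : C) (p1 : hom A A1) (p2 : hom A A2)
          (X1 X2 : C) (q1 : hom X X1) (q2 : hom X X2)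
          (g1 : hom A1 X1) (g2 : hom A2 X2),
     is_product p1 p2 -> is_product q1 q2 ->
     q1 ∘ f = g1 ∘ p1 -> q2 ∘ f = g2 ∘ p2 ->
     is_pushout f p1 q1 g1 /\ is_pushout f p2 q2 g2).

Definition coextensive : Prop :=
  has_finite_products /\
  forall (A X : C) (f : hom A X), coextensive_morphism f.

End CategoryNotions.

Declare Scope hoop_scope.
Delimit Scope hoop_scope with hoop.

Record hoop : Type := Hoop {
  hcarrier :> Type;
  hmul : hcarrier -> hcarrier -> hcarrier;
  himp : hcarrier -> hcarrier -> hcarrier;
  hone : hcarrier;
  hmulA : associative hmul;
  hmulC : commutative hmul;
  hmul1 : left_id hone hmul;
  himpxx : forall x, himp x x = hone;
  himp_curry : forall x y z, himp x (himp y z) = himp (hmul x y) z;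
  himp_div : forall x y, hmul (himp x y) x = hmul (himp y x) y
}.

Notation "x · y" := (hmul x y) (at level 40, left associativity) : hoop_scope.
Notation "x ⇒ y" := (himp x y) (at level 55, right associativity) : hoop_scope.
Local Open Scope hoop_scope.

Section HoopNotions.
Variable H : hoop.
Implicit Types x y z : H.

Definition hle x y : Prop := x ⇒ y = hone H.

Definition hmeet x y : H := (y ⇒ x) · y.

Definition pseudojoin x y : H := hmeet ((x ⇒ y) ⇒ y) ((y ⇒ x) ⇒ x).

Definition is_join x y j : Prop :=
  [/\ hle x j, hle y j & forall z, hle x z -> hle y z -> hle j z].

Definition vee_hoop : Prop := forall x y, is_join x y (pseudojoin x y).

End HoopNotions.

Record bounded_vee_hoop : Type := BoundedVeeHoop {
  bvh_hoop :> hoop;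
  bvh_zero : bvh_hoop;
  bvh_zero_le : forall x : bvh_hoop, hle bvh_zero x;
  bvh_vee : vee_hoop bvh_hoop
}.

Record bvh_hom (H K : bounded_vee_hoop) : Type := BvhHom {
  bvh_fun :> H -> K;
  bvh_homM : forall x y, bvh_fun (x · y) = bvh_fun x · bvh_fun y;
  bvh_homI : forall x y, bvh_fun (x ⇒ y) = bvh_fun x ⇒ bvh_fun y;
  bvh_hom1 : bvh_fun (hone H) = hone K;
  bvh_hom0 : bvh_fun (bvh_zero H) = bvh_zero K
}.

Lemma bvh_hom_eq (H K : bounded_vee_hoop) (f g : bvh_hom H K) :
  (forall x, f x = g x) -> f = g.
Proof.
case: f g => [f fM fI f1 f0] [g gM gI g1 g0] /= fg.
have {}fg : f = g by apply/funext.
by subst g; congr BvhHom; exact: Prop_irrelevance.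
Qed.

Definition bvh_id (H : bounded_vee_hoop) : bvh_hom H H :=
  @BvhHom H H id (fun _ _ => erefl) (fun _ _ => erefl) erefl erefl.

Program Definition bvh_comp (H K L : bounded_vee_hoop)
    (g : bvh_hom K L) (f : bvh_hom H K) : bvh_hom H L :=
  @BvhHom H L (fun x => g (f x)) _ _ _ _.
Next Obligation. by move=> *; rewrite !bvh_homM. Qed.
Next Obligation. by move=> *; rewrite !bvh_homI. Qed.
Next Obligation. by move=> *; rewrite !bvh_hom1. Qed.
Next Obligation. by move=> *; rewrite !bvh_hom0. Qed.

Lemma bvh_comp_id_l (H K : bounded_vee_hoop) (f : bvh_hom H K) :
  bvh_comp (bvh_id K) f = f.
Proof. exact: bvh_hom_eq. Qed.

Lemma bvh_comp_id_r (H K : bounded_vee_hoop) (f : bvh_hom H K) :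
  bvh_comp f (bvh_id H) = f.
Proof. exact: bvh_hom_eq. Qed.

Lemma bvh_compA (H K L M : bounded_vee_hoop)
    (h : bvh_hom L M) (g : bvh_hom K L) (f : bvh_hom H K) :
  bvh_comp h (bvh_comp g f) = bvh_comp (bvh_comp h g) f.
Proof. exact: bvh_hom_eq. Qed.

Definition BHp_vee : category :=
  @Category bounded_vee_hoop bvh_hom bvh_id bvh_comp
    bvh_comp_id_l bvh_comp_id_r bvh_compA.

(* Main.v *)
(** The projections of a product A1 <- A -> A2 are quotients: if e is the
    element of A with components (1, 0), then e is idempotent and A1 is A
    modulo the relation e x = e y, so that A -> A1 is universal among the
    morphisms sending e to 1.  Hence the pushout of A -> A1 along f : A -> X is
    the quotient of X by f(e).  The complement e' = (0, 1) satisfies e e' = 0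
    and e ⊔ e' = 1, equations which f preserves; as the pseudojoin is a genuine
    join in X, they force the quotients of X by f(e) and f(e') to form a product
    diagram.  Conversely, in a commutative diagram between two products, f(e)
    is the element (1, 0) of X. *)
From mathcomp Require Import all_boot.
From mathcomp Require Import boolp.
Require Import Defs.

Set Implicit Arguments.
Unset Strict Implicit.
Unset Printing Implicit Defensive.

Local Open Scope hoop_scope.

(** * Arithmetic of hoops and complementary idempotents *)

Section HoopTheory.
Variable H : hoop.
Implicit Types x y z u v : H.
Local Notation one := (hone H).

Lemma hmulx1 x : x · one = x.
Proof. by rewrite hmulC hmul1. Qed.

Lemma hmulCA x y z : x · (y · z) = y · (x · z).
Proof. by rewrite hmulA (hmulC x) -hmulA. Qed.

Lemma hle_anti x y : hle x y -> hle y x -> x = y.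
Proof. by rewrite /hle => xy yx; have := himp_div x y; rewrite xy yx !hmul1. Qed.

(** Divisibility gives [one ⇒ x = (x ⇒ one) · x], and uncurrying leaves an instance of [himpxx].
    This is a first step towards [one] being the top element, which is not an axiom. *)
Lemma himp1_himp1 x : (one ⇒ x) ⇒ one = one.
Proof.
have -> : one ⇒ x = (x ⇒ one) · x by rewrite -himp_div hmulx1.
by rewrite -himp_curry himpxx.
Qed.

Lemma himp1 x : one ⇒ x = x.
Proof.
apply: hle_anti; last by rewrite /hle himp_curry hmulx1 himpxx.
have {1}-> : one ⇒ x = (x ⇒ one) · x by rewrite -himp_div hmulx1.
(* With [x ⇒ one] in this form, uncurrying leaves [himp1_himp1] at [x ⇒ one]. *)
have {1}-> : x ⇒ one = one ⇒ (x ⇒ one) by rewrite himp_curry hmul1.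
by rewrite /hle -himp_curry himpxx himp1_himp1.
Qed.

Lemma himpx1 x : x ⇒ one = one.
Proof. by rewrite -{1}(himp1 x) himp1_himp1. Qed.

Lemma hle_refl x : hle x x.
Proof. exact: himpxx. Qed.

Lemma hle_mulr x y : hle (x · y) y.
Proof. by rewrite /hle -himp_curry himpxx himpx1. Qed.

Lemma hle_mull x y : hle (x · y) x.
Proof. by rewrite hmulC; exact: hle_mulr. Qed.

Lemma hle_himp x y z : hle x (y ⇒ z) <-> hle (x · y) z.
Proof. by rewrite /hle himp_curry. Qed.

Lemma hle_mulE x y : hle x y -> x = (y ⇒ x) · y.
Proof. by move=> xy; rewrite -himp_div xy hmul1. Qed.

Lemma hle_trans y x z : hle x y -> hle y z -> hle x z.
Proof.
by move=> /hle_mulE -> yz; rewrite /hle -himp_curry yz himpx1.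
Qed.

Lemma hle_mul2l z x y : hle x y -> hle (z · x) (z · y).
Proof. by move=> /hle_mulE ->; rewrite hmulCA; exact: hle_mulr. Qed.

Lemma himp_mul_le x y : hle ((x ⇒ y) · x) y.
Proof. by apply/hle_himp/hle_refl. Qed.

Lemma hmeet11 : hmeet one one = one.
Proof. by rewrite /hmeet himpxx hmul1. Qed.

Lemma pseudojoin1x x : pseudojoin one x = one.
Proof. by rewrite /pseudojoin himp1 himpxx himpx1 hmeet11. Qed.

Lemma pseudojoinx1 x : pseudojoin x one = one.
Proof. by rewrite /pseudojoin himp1 himpxx himpx1 hmeet11. Qed.

(** Idempotency allows one copy of [u] to be kept outside while another is spent inside, so each
    inequality reduces to residuation. This and the next lemma make [u · _] compatible with
    implication. *)
Lemma idem_imp_mulr u x y : u · u = u -> u · (x ⇒ u · y) = u · (x ⇒ y).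
Proof.
move=> uu; apply: hle_anti; rewrite -{1}uu -hmulA; apply: hle_mul2l;
  apply/hle_himp; rewrite -hmulA.
  apply: hle_trans (hle_mulr _ _) _.
  exact: hle_trans (himp_mul_le _ _) (hle_mulr _ _).
exact/hle_mul2l/himp_mul_le.
Qed.

Lemma idem_imp_mull u x y : u · u = u -> u · (u · x ⇒ y) = u · (x ⇒ y).
Proof.
move=> uu; apply: hle_anti; rewrite -{1}uu -hmulA; apply: hle_mul2l;
  apply/hle_himp.
  by rewrite -hmulA hmulCA; exact: himp_mul_le.
rewrite -hmulA [_ · (u · x)]hmulCA.
do 2!(apply: hle_trans (hle_mulr _ _) _).
exact: himp_mul_le.
Qed.

Definition complementary u v bot : Prop :=
  [/\ u · u = u, v · v = v, u · v = bot & pseudojoin u v = one].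

(** From [u · a = u · b] follows [u ≤ a ⇒ b], and likewise for [v]; the join of [u] and [v] is
    [one], so [one ≤ a ⇒ b]. *)
Lemma complementary_inj u v bot x y : vee_hoop H -> complementary u v bot ->
  u · x = u · y -> v · x = v · y -> x = y.
Proof.
have le a b : vee_hoop H -> complementary u v bot ->
    u · a = u · b -> v · a = v · b -> hle a b.
  move=> vee [_ _ _ uv1] uab vab.
  have [_ _ lub] := vee u v; rewrite uv1 in lub.
  have : hle one (a ⇒ b).
    by apply: lub; apply/hle_himp; rewrite ?uab ?vab; exact: hle_mulr.
  by rewrite /hle himp1.
by move=> *; apply: hle_anti; apply: le.
Qed.

End HoopTheory.

(** * Quotients by an idempotent and their universal property *)

Section Quotient.
Variables (H : bounded_vee_hoop) (u : H) (uu : u · u = u).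

(** The fixed points of [u · _] are canonical representatives of the classes of the congruence
    [u · x = u · y]. *)
Definition quot_carrier : Type := {x : H | u · x = x}.
Implicit Types x y z : quot_carrier.

Lemma quot_eq x y : sval x = sval y -> x = y.
Proof.
by case: x y => [a ua] [b ub] /= ab; subst b; congr exist; exact: Prop_irrelevance.
Qed.

Fact quot_of_subproof (x : H) : u · (u · x) = u · x.
Proof. by rewrite hmulA uu. Qed.

Definition quot_of (x : H) : quot_carrier := exist _ _ (quot_of_subproof x).

Definition quot_mul x y := quot_of (sval x · sval y).
Definition quot_imp x y := quot_of (sval x ⇒ sval y).

Lemma quot_ofK x : quot_of (sval x) = x.
Proof. by apply: quot_eq; exact: svalP x. Qed.

Lemma quot_ofM (x y : H) : quot_of (x · y) = quot_mul (quot_of x) (quot_of y).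
Proof. by apply: quot_eq => /=; rewrite -hmulA (hmulCA x) !hmulA !uu. Qed.

Lemma quot_ofI (x y : H) : quot_of (x ⇒ y) = quot_imp (quot_of x) (quot_of y).
Proof. by apply: quot_eq => /=; rewrite idem_imp_mull // idem_imp_mulr. Qed.

(** Together with [quot_ofM] and [quot_ofI], this transfers the hoop axioms from [H]. *)
Lemma quot_of_surj x : exists a, x = quot_of a.
Proof. by exists (sval x); rewrite quot_ofK. Qed.

Fact quot_mulA : associative quot_mul.
Proof.
move=> x y z; have [a ->] := quot_of_surj x; have [b ->] := quot_of_surj y.
have [c ->] := quot_of_surj z.
by rewrite -!quot_ofM hmulA.
Qed.

Fact quot_mulC : commutative quot_mul.
Proof. by move=> x y; rewrite /quot_mul hmulC. Qed.

Fact quot_mul1 : left_id (quot_of (hone H)) quot_mul.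
Proof. by move=> x; have [a ->] := quot_of_surj x; rewrite -quot_ofM hmul1. Qed.

Fact quot_impxx x : quot_imp x x = quot_of (hone H).
Proof. by rewrite /quot_imp himpxx. Qed.

Fact quot_imp_curry x y z :
  quot_imp x (quot_imp y z) = quot_imp (quot_mul x y) z.
Proof.
have [a ->] := quot_of_surj x; have [b ->] := quot_of_surj y.
have [c ->] := quot_of_surj z.
by rewrite -quot_ofM -!quot_ofI himp_curry.
Qed.

Fact quot_imp_div x y :
  quot_mul (quot_imp x y) x = quot_mul (quot_imp y x) y.
Proof.
have [a ->] := quot_of_surj x; have [b ->] := quot_of_surj y.
by rewrite -!quot_ofI -!quot_ofM himp_div.
Qed.

Definition quot_hoop : hoop :=
  Hoop quot_mulA quot_mulC quot_mul1 quot_impxx quot_imp_curry quot_imp_div.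

(** If [u · (x ⇒ y) = u], then [u ≤ x ⇒ y], hence [u · x ≤ y], where [u · x = x]. *)
Lemma quot_hleE (x y : quot_hoop) : hle x y <-> hle (sval x) (sval y).
Proof.
split=> [/(congr1 sval) /= uxy | xy].
  rewrite hmulx1 in uxy.
  have := hle_mulr u (sval x ⇒ sval y); rewrite uxy => /hle_himp.
  by rewrite (svalP x).
by apply: quot_eq => /=; rewrite xy.
Qed.

Lemma quot_pseudojoin (x y : quot_hoop) :
  pseudojoin x y = quot_of (pseudojoin (sval x) (sval y)).
Proof.
by rewrite /pseudojoin /hmeet !(quot_ofM, quot_ofI, quot_ofK).
Qed.

Fact quot_zero_le (x : quot_hoop) : hle (quot_of (bvh_zero H) : quot_hoop) x.
Proof. by apply/quot_hleE/(hle_trans (hle_mulr _ _))/bvh_zero_le. Qed.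

Fact quot_vee : vee_hoop quot_hoop.
Proof.
move=> x y; rewrite quot_pseudojoin.
have [xj yj lub] := @bvh_vee H (sval x) (sval y).
split=> [||z /quot_hleE xz /quot_hleE yz]; apply/quot_hleE => /=.
- by rewrite -{1}(svalP x); exact: hle_mul2l.
- by rewrite -{1}(svalP y); exact: hle_mul2l.
- exact: hle_trans (hle_mulr _ _) (lub _ xz yz).
Qed.

Definition quot_bvh : bounded_vee_hoop := BoundedVeeHoop quot_zero_le quot_vee.

Definition quot_hom : bvh_hom H quot_bvh :=
  @BvhHom H quot_bvh quot_of quot_ofM quot_ofI erefl erefl.

End Quotient.

(** Describes [quot_hom] up to isomorphism, so that product projections and arbitrary pushout legs
    can be recognised as quotients. *)
Definition is_quotient (H K : bounded_vee_hoop) (q : bvh_hom H K) (u : H) :=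
  (forall y, exists x, q x = y) /\ forall x y, q x = q y <-> u · x = u · y.

Lemma quot_homP (H : bounded_vee_hoop) (u : H) (uu : u · u = u) :
  is_quotient (quot_hom uu) u.
Proof.
split=> [y | x y]; first by have [x ->] := quot_of_surj uu y; exists x.
by split=> [/(congr1 sval) | uxy]; last exact: quot_eq.
Qed.

Lemma bvh_comp_eqP (H K L M : bounded_vee_hoop) (g : bvh_hom K M)
    (f : bvh_hom H K) (g' : bvh_hom L M) (f' : bvh_hom H L) :
  bvh_comp g f = bvh_comp g' f' <-> forall x, g (f x) = g' (f' x).
Proof.
split=> [fg x | fg]; last by apply: bvh_hom_eq => x; exact: fg.
by have := congr1 (fun h : bvh_hom H M => h x) fg.
Qed.

Lemma bvh_compP (H K M : bounded_vee_hoop) (g : bvh_hom K M)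
    (f : bvh_hom H K) (k : bvh_hom H M) :
  bvh_comp g f = k <-> forall x, g (f x) = k x.
Proof. by rewrite -[k in _ = k]bvh_comp_id_l; exact: bvh_comp_eqP. Qed.

(** The map [k] is constant on the fibres of [q], because [k x = k u · k x = k (u · x)]. Composing
    [k] with any set-theoretic section of [q] therefore gives a morphism. *)
Lemma quotient_factor (H K L : bounded_vee_hoop) (q : bvh_hom H K) (u : H)
    (k : bvh_hom H L) : is_quotient q u -> k u = hone L ->
  exists h : bvh_hom K L, forall x, h (q x) = k x.
Proof.
move=> [qsurj qE] ku1.
have [s sK] := choice qsurj.
have ks x : k (s (q x)) = k x.
  have /qE/(congr1 k) := sK (q x).
  by rewrite !bvh_homM ku1 !hmul1.
have hM x y : k (s (x · y)) = k (s x) · k (s y).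
  by rewrite -bvh_homM -{1}(sK x) -{1}(sK y) -bvh_homM ks.
have hI x y : k (s (x ⇒ y)) = k (s x) ⇒ k (s y).
  by rewrite -bvh_homI -{1}(sK x) -{1}(sK y) -bvh_homI ks.
have h1 : k (s (hone K)) = hone L by rewrite -(bvh_hom1 q) ks bvh_hom1.
have h0 : k (s (bvh_zero K)) = bvh_zero L by rewrite -(bvh_hom0 q) ks bvh_hom0.
by exists (@BvhHom K L (fun y => k (s y)) hM hI h1 h0).
Qed.

Lemma quotient_unit (H K : bounded_vee_hoop) (q : bvh_hom H K) (u : H) :
  u · u = u -> is_quotient q u -> q u = hone K.
Proof. by move=> uu [_ qE]; rewrite -(bvh_hom1 q); apply/qE; rewrite uu hmulx1. Qed.

(** * Products, and binary product diagrams in terms of elements *)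

Section Product.
Variables (I : Type) (F : I -> bounded_vee_hoop).
Local Notation P := (forall i, F i).

Definition prod_hoop : hoop.
Proof.
refine (@Hoop P (fun x y i => x i · y i) (fun x y i => x i ⇒ y i)
  (fun i => hone (F i)) _ _ _ _ _ _);
  move=> *; apply: functional_extensionality_dep => i;
  by [exact: hmulA | exact: hmulC | exact: hmul1 | exact: himpxx
     | exact: himp_curry | exact: himp_div].
Defined.

Lemma prod_hleE (x y : prod_hoop) : hle x y <-> forall i, hle (x i) (y i).
Proof.
split=> [xy i|]; last exact: functional_extensionality_dep.
by have := congr1 (fun f : P => f i) xy.
Qed.

Fact prod_zero_le (x : prod_hoop) : @hle prod_hoop (fun i => bvh_zero (F i)) x.
Proof. by apply/prod_hleE => i; exact: bvh_zero_le. Qed.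

Fact prod_vee : vee_hoop prod_hoop.
Proof.
move=> x y; split=> [||z /prod_hleE xz /prod_hleE yz]; apply/prod_hleE => i;
  have [? ? lub] := @bvh_vee (F i) (x i) (y i) => //.
exact: lub.
Qed.

Definition prod_bvh : bounded_vee_hoop := BoundedVeeHoop prod_zero_le prod_vee.

Definition prod_proj (i : I) : bvh_hom prod_bvh (F i) :=
  @BvhHom prod_bvh (F i) (fun x => x i)
    (fun _ _ => erefl) (fun _ _ => erefl) erefl erefl.

Lemma prod_pairing (Y : bounded_vee_hoop) (y : forall i, bvh_hom Y (F i)) :
  exists h : bvh_hom Y prod_bvh, forall i t, prod_proj i (h t) = y i t.
Proof.
unshelve eexists (@BvhHom Y prod_bvh (fun t i => y i t) _ _ _ _) => //;
  move=> *; apply: functional_extensionality_dep => i;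
  by [exact: bvh_homM | exact: bvh_homI | exact: bvh_hom1 | exact: bvh_hom0].
Qed.

End Product.

Lemma BHp_vee_finite_products : has_finite_products BHp_vee.
Proof.
move=> n F; exists (prod_bvh F), (@prod_proj _ F) => Y y.
have [h hE] := prod_pairing y.
exists h; split=> [i|h' h'E]; first exact/bvh_compP.
apply: bvh_hom_eq => t; apply: functional_extensionality_dep => i.
have /bvh_compP/(_ t) h'i := h'E i.
exact: etrans (hE i t) (esym h'i).
Qed.

Section BinaryProducts.
Variables (A A1 A2 : bounded_vee_hoop) (p1 : bvh_hom A A1) (p2 : bvh_hom A A2).

Lemma is_productP : @is_product BHp_vee A A1 A2 p1 p2 <->
  (forall x y, p1 x = p1 y -> p2 x = p2 y -> x = y) /\
  (forall a b, exists x, p1 x = a /\ p2 x = b).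
Proof.
split=> [prod | [inj surj] Y y1 y2]; last first.
  have ex t : exists x, p1 x = y1 t /\ p2 x = y2 t by exact: surj.
  (* Joint injectivity forces the chosen pairing [s] to be a morphism and to be unique. *)
  have [s sE] := choice ex.
  have s1 t : p1 (s t) = y1 t by have [] := sE t.
  have s2 t : p2 (s t) = y2 t by have [] := sE t.
  unshelve eexists (@BvhHom Y A s _ _ _ _).
  - by move=> x y; apply: inj; rewrite !(bvh_homM, s1, s2).
  - by move=> x y; apply: inj; rewrite !(bvh_homI, s1, s2).
  - by apply: inj; rewrite !(bvh_hom1, s1, s2).
  - by apply: inj; rewrite !(bvh_hom0, s1, s2).
  split=> [|h [/bvh_compP h1 /bvh_compP h2]]; first by split; exact/bvh_compP.
  by apply: bvh_hom_eq => t /=; apply: inj; rewrite ?s1 ?s2 ?h1 ?h2.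
(* For the direct implication, [A] is compared with the concrete product indexed by [bool]. *)
pose F (b : bool) : bounded_vee_hoop := if b then A1 else A2.
pose P := prod_bvh F.
have [k [kE _]] := prod P (@prod_proj _ F true) (@prod_proj _ F false).
have [/bvh_compP k1 /bvh_compP k2] := kE.
have [h hE] := prod_pairing
  (fun b => match b return bvh_hom A (F b) with true => p1 | false => p2 end).
(* Both [k] after [h] and the identity mediate the cone [p1], [p2] over itself. *)
have kh x : k (h x) = x.
  have [i [_ iU]] := prod A p1 p2.
  rewrite -[RHS]/(bvh_id A x) -[LHS]/(bvh_comp k h x); congr (bvh_fun _ x).
  rewrite -(iU (bvh_comp k h)); first apply: iU.
  - by split; exact/bvh_compP.
  - split; apply/bvh_compP => t /=.
    + by rewrite k1; exact: (hE true).
    + by rewrite k2; exact: (hE false).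
split=> [x y xy1 xy2 | a b].
  have hxy c : prod_proj F c (h x) = prod_proj F c (h y) by rewrite !hE; case: c.
  by rewrite -(kh x) -(kh y); congr (k _); exact: functional_extensionality_dep.
exists (k (fun c => match c return F c with true => a | false => b end)).
by rewrite k1 k2.
Qed.

Hypothesis prod : @is_product BHp_vee A A1 A2 p1 p2.

(** Multiplication by [e], which is (1, 0), keeps the first component and sends the second to 0. *)
Lemma product_quotient (e : A) : p1 e = hone A1 -> p2 e = bvh_zero A2 ->
  is_quotient p1 e.
Proof.
have [inj surj] := (is_productP.1 prod).
have mul0 x : bvh_zero A2 · x = bvh_zero A2.
  by apply: hle_anti; [exact: hle_mull | exact: bvh_zero_le].
move=> e1 e2; split=> [a | x y]; first by have [x []] := surj a (hone A2); exists x.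
split=> [xy | /(congr1 p1)]; last by rewrite !bvh_homM e1 !hmul1.
by apply: inj; rewrite !bvh_homM ?xy // e2 !mul0.
Qed.

Lemma product_complementary (e e' : A) :
  p1 e = hone A1 -> p2 e = bvh_zero A2 ->
  p1 e' = bvh_zero A1 -> p2 e' = hone A2 -> complementary e e' (bvh_zero A).
Proof.
have [inj _] := (is_productP.1 prod).
have mul00 (K : bounded_vee_hoop) : bvh_zero K · bvh_zero K = bvh_zero K.
  by apply: hle_anti; [exact: hle_mull | exact: bvh_zero_le].
(* The pseudojoin is a term in the hoop operations, so morphisms preserve it. *)
have pj (K : bounded_vee_hoop) (p : bvh_hom A K) x y :
    p (pseudojoin x y) = pseudojoin (p x) (p y).
  by rewrite /pseudojoin /hmeet !(bvh_homM, bvh_homI).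
move=> e1 e2 e1' e2'.
by split; apply: inj;
  rewrite ?pj ?bvh_homM ?bvh_hom1 ?bvh_hom0 ?(e1, e2, e1', e2') //
    ?(hmul1, hmulx1, pseudojoin1x, pseudojoinx1).
Qed.

End BinaryProducts.

Lemma is_product_sym (A A1 A2 : bounded_vee_hoop)
    (p1 : bvh_hom A A1) (p2 : bvh_hom A A2) :
  @is_product BHp_vee A A1 A2 p1 p2 -> @is_product BHp_vee A A2 A1 p2 p1.
Proof.
move=> /is_productP[inj surj]; apply/is_productP.
split=> [x y xy2 xy1 | a b]; first exact: inj.
by have [x [x1 x2]] := surj b a; exists x.
Qed.

Lemma quotient_product (X X1 X2 : bounded_vee_hoop) (u v : X)
    (q1 : bvh_hom X X1) (q2 : bvh_hom X X2) :
  complementary u v (bvh_zero X) -> is_quotient q1 u -> is_quotient q2 v ->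
  @is_product BHp_vee X X1 X2 q1 q2.
Proof.
move=> cuv Q1 Q2; have [uu vv uv _] := cuv; have [[s1 E1] [s2 E2]] := (Q1, Q2).
apply/is_productP; split=> [x y /E1 uxy /E2 vxy | a b].
  exact: complementary_inj (@bvh_vee X) cuv uxy vxy.
have [[x1 <-] [x2 <-]] := conj (s1 a) (s2 b).
have q1u := quotient_unit uu Q1; have q2v := quotient_unit vv Q2.
have q1v : q1 v = bvh_zero X1.
  by rewrite -(hmul1 (q1 v)) -q1u -bvh_homM uv bvh_hom0.
have q2u : q2 u = bvh_zero X2.
  by rewrite -(hmulx1 (q2 u)) -q2v -bvh_homM uv bvh_hom0.
(* Under [q1], [u] becomes 1 and [v] becomes 0, so the factors become [q1 x1] and 1; under [q2] the
   roles are exchanged. *)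
exists ((u ⇒ x1) · (v ⇒ x2)).
by rewrite !bvh_homM !bvh_homI q1u q1v q2u q2v !himp1 !bvh_zero_le hmul1 hmulx1.
Qed.

(** * Pushouts of quotients by idempotents *)

Section Pushouts.
Variables (A X B : bounded_vee_hoop) (f : bvh_hom A X) (p : bvh_hom A B) (e : A).
Hypotheses (ee : e · e = e) (Qp : is_quotient p e).

(** In any cocone, [x (f e) = b (p e) = 1], so [x] factors through [q]. Surjectivity of [p] gives
    agreement with [b], and surjectivity of [q] gives uniqueness. *)
Lemma quotient_pushout (Y : bounded_vee_hoop) (q : bvh_hom X Y)
    (g : bvh_hom B Y) : (forall x, q (f x) = g (p x)) -> is_quotient q (f e) ->
  @is_pushout BHp_vee A X B Y f p q g.
Proof.
move=> sq Qq; split=> [|Z x b /bvh_comp_eqP xb]; first exact/bvh_comp_eqP.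
have xe : x (f e) = hone Z by rewrite xb (quotient_unit ee Qp) bvh_hom1.
have [h hq] := quotient_factor Qq xe.
exists h; split=> [|h' [/bvh_compP h'q _]].
  split; apply/bvh_compP => // t; have [t' <-] := Qp.1 t.
  by rewrite -sq hq xb.
by apply: bvh_hom_eq => y; have [t <-] := Qq.1 y; rewrite hq h'q.
Qed.

Let fefe : f e · f e = f e. Proof. by rewrite -bvh_homM ee. Qed.

Lemma exists_quotient_square :
  exists g : bvh_hom B (quot_bvh fefe), forall x, quot_hom fefe (f x) = g (p x).
Proof.
have pe : bvh_comp (quot_hom fefe) f e = hone (quot_bvh fefe).
  exact: quotient_unit fefe (quot_homP fefe).
by have [g gp] := quotient_factor Qp pe; exists g => x; rewrite gp.
Qed.

Lemma quotient_admits_pushout : @admits_pushout BHp_vee A X B f p.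
Proof.
have [g sq] := exists_quotient_square.
by exists (quot_bvh fefe), (quot_hom fefe), g; exact: quotient_pushout (quot_homP _).
Qed.

(** Coextensivity speaks of every pushout, so an arbitrary one is compared with the concrete
    quotient [r]: the map [k] from the quotient to [Y] has [h] as a section, and [h] after [q] is
    [r], so [q] is surjective with the kernel of [r]. *)
Lemma pushout_quotient (Y : bounded_vee_hoop) (q : bvh_hom X Y)
    (g : bvh_hom B Y) :
  @is_pushout BHp_vee A X B Y f p q g -> is_quotient q (f e).
Proof.
move=> [/bvh_comp_eqP sq univ].
have [g0 sq0] := exists_quotient_square.
have Qr := quot_homP fefe; set r := quot_hom fefe in sq0 Qr.
have qe : q (f e) = hone Y by rewrite sq (quotient_unit ee Qp) bvh_hom1.
have [k kr] := quotient_factor Qr qe.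
have [h [[/bvh_compP hq /bvh_compP hg] _]] :=
  univ _ r g0 ((bvh_comp_eqP _ _ _ _).2 sq0).
have kh y : k (h y) = y.
  have [i [_ iU]] := univ Y q g ((bvh_comp_eqP _ _ _ _).2 sq).
  rewrite -[RHS]/(bvh_id Y y) -[LHS]/(bvh_comp k h y); congr (bvh_fun _ y).
  rewrite -(iU (bvh_comp k h)); first apply: iU.
  - by split; exact/bvh_compP.
  - split; apply/bvh_compP => t /=; first by rewrite hq kr.
    by rewrite hg; have [t' <-] := Qp.1 t; rewrite -sq0 kr sq.
split=> [y | x y].
  by have [x xE] := Qr.1 (h y); exists x; rewrite -kr xE kh.
split=> [/(congr1 h) | /(congr1 q)]; first by rewrite !hq => /Qr.2.
by rewrite !bvh_homM qe !hmul1.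
Qed.

End Pushouts.

(** * Coextensivity *)

Lemma complementary_hom (A X : bounded_vee_hoop) (f : bvh_hom A X) (e e' : A) :
  complementary e e' (bvh_zero A) -> complementary (f e) (f e') (bvh_zero X).
Proof.
move=> [ee ee' e0 e1]; split; rewrite -?bvh_homM ?ee ?ee' ?e0 ?bvh_hom0 //.
by rewrite -(bvh_hom1 f) -e1 /pseudojoin /hmeet !(bvh_homM, bvh_homI).
Qed.

Lemma product_idempotents (A A1 A2 : bounded_vee_hoop)
    (p1 : bvh_hom A A1) (p2 : bvh_hom A A2) :
  @is_product BHp_vee A A1 A2 p1 p2 ->
  exists e e' : A, [/\ complementary e e' (bvh_zero A),
    p1 e = hone A1 /\ p2 e = bvh_zero A2,
    p1 e' = bvh_zero A1 /\ p2 e' = hone A2,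
    is_quotient p1 e & is_quotient p2 e'].
Proof.
move=> prod; have [_ surj] := (is_productP _ _).1 prod.
have [e [e1 e2]] := surj (hone A1) (bvh_zero A2).
have [e' [e1' e2']] := surj (bvh_zero A1) (hone A2).
exists e, e'; split=> //.
- exact: (product_complementary prod e1 e2 e1' e2').
- exact: (product_quotient prod e1 e2).
- exact: (product_quotient (is_product_sym prod) e2' e1').
Qed.

Theorem corollary2p7 : coextensive BHp_vee.
Proof.
split=> [|A X f]; first exact: BHp_vee_finite_products.
split=> [A1 A2 p1 p2 prod | A1 A2 p1 p2 X1 X2 q1 q2 g1 g2 prod prodX];
  have [e [e' [c [e1 e2] [e1' e2'] Q1 Q2]]] := product_idempotents prod;
  have [ee ee' _ _] := c.
  split=> [||X1 X2 q1 q2 g1 g2 po1 po2].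
  - exact: quotient_admits_pushout ee Q1.
  - exact: quotient_admits_pushout ee' Q2.
  - apply: quotient_product (complementary_hom f c) _ _.
    + exact: pushout_quotient ee Q1 _ _ _ po1.
    + exact: pushout_quotient ee' Q2 _ _ _ po2.
move=> /bvh_comp_eqP sq1 /bvh_comp_eqP sq2.
(* Commutativity of the squares gives [f e] the components (1, 0), and [f e'] the components (0, 1),
   in the product [X]. *)
have Q1' : is_quotient q1 (f e).
  apply: (product_quotient prodX).
  - by rewrite sq1 e1 bvh_hom1.
  - by rewrite sq2 e2 bvh_hom0.
have Q2' : is_quotient q2 (f e').
  apply: (product_quotient (is_product_sym prodX)).
  - by rewrite sq2 e2' bvh_hom1.
  - by rewrite sq1 e1' bvh_hom0.
by split; [exact: quotient_pushout ee Q1 _ _ _ sq1 Q1'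
         | exact: quotient_pushout ee' Q2 _ _ _ sq2 Q2'].
Qed.
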